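(* Assume that $A_n\in\mathbf{M}_n(\mathbb{C})$ for each $n\ge1$ and that $\|A_n\|^2/n\to0$ as $n\to\infty$. Then the measure $\mu_{A_n}-\delta_{\overline{\mu}_{A_n}}$ converges weakly to zero as $n\to\infty$.
   Context: $\mathbf{M}_n(\mathbb{C})$ is the set of complex $n\times n$ matrices, and $\|A\|=\sup\{\|Ax\|:x\in\mathbb{C}^n,\ \|x\|=1\}$ is the operator norm associated with the Euclidean norm on $\mathbb{C}^n$. The numerical measure $\mu_A$ of $A\in\mathbf{M}_n(\mathbb{C})$ is the probability measure on $\mathbb{C}$ defined as the image, under the map $x\mapsto\langle Ax,x\rangle$ (with $\langle x,y\rangle=y^*x$), of the Euclidean measure on the unit sphere of $\mathbb{C}^n$ normalized as a probability measure. Its first moment is $\overline{\mu}_A=\int_{\mathbb{C}}z\,\mathrm{d}\mu_A(z)=\frac1n\mathrm{Tr}(A)$, and $\delta_w$ denotes the Dirac mass at $w\in\mathbb{C}$.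
   Formalization: ''Converges weakly to zero'' is taken against bounded uniformly continuous test functions; with all bounded continuous functions the claim fails when the means escape to infinity (e.g. n=4^k, A_n=kI+diag(1,-1,1,-1,...), and A_n=0 for other n). *)

(* Defs.v *)
From HB Require Import structures.
From mathcomp Require Import all_boot all_order all_algebra.
From mathcomp Require Import all_classical all_reals all_analysis.
From mathcomp Require Import measurable_realfun complex lra.

Set Implicit Arguments.
Unset Strict Implicit.
Unset Printing Implicit Defensive.

Import Order.TTheory GRing.Theory Num.Theory numFieldNormedType.Exports.

Local Open Scope classical_set_scope.
Local Open Scope complex_scope.
Local Open Scope ring_scope.

(* R[i] carries the topology of its modulus and the Borel sigma-algebra. *)
HB.instance Definition _ (R : realType) := NormedModule.copy R[i] (R[i]^o).
HB.instance Definition _ (R : realType) :=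
  Measurable.copy R[i] (g_sigma_algebraType (@open R[i])).

Section complex_borel.
Context {R : realType}.
Implicit Types (U : set R[i]) (z w : R[i]) (a b e : R).

Lemma normc_lt z e : 0 < e ->
  complex.Re z ^+ 2 + complex.Im z ^+ 2 < e ^+ 2 -> `|z| < e%:C.
Proof.
case: z => a b /= e0 h; rewrite normc_def /= ltcR.
rewrite -(ger0_norm (ltW e0)) -sqrtr_sqr ltr_sqrt //.
exact: exprn_gt0.
Qed.

Let box a b e : set R[i] :=
  [set z | `|complex.Re z - a| < e /\ `|complex.Im z - b| < e].

Lemma open_box U z : open U -> U z -> exists a b e : rat,
  box (ratr a) (ratr b) (ratr e) z /\ box (ratr a) (ratr b) (ratr e) `<=` U.
Proof.
move=> oU Uz.
have : nbhs z U by exact: open_nbhs_nbhs.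
move=> /nbhs_ballP[[e0 e1] /= e_gt0 zU].
have [e00 e10] : 0 < e0 /\ e1 = 0.
  by move: e_gt0; rewrite ltcE /= => /andP[/eqP -> ?].
subst e1.
have /rat_in_itvoo[q] : 0 < e0 / 4%:R by rewrite divr_gt0.
rewrite in_itv /= => /andP[q0 qe].
have [a ha] : exists a : rat, `|complex.Re z - ratr a| < ratr q.
  have /rat_in_itvoo[a] : complex.Re z - ratr q < complex.Re z + ratr q.
    by rewrite ltrD2l (lt_trans _ q0)// oppr_lt0.
  rewrite in_itv /= => /andP[h1 h2]; exists a; rewrite ltr_norml; lra.
have [b hb] : exists b : rat, `|complex.Im z - ratr b| < ratr q.
  have /rat_in_itvoo[b] : complex.Im z - ratr q < complex.Im z + ratr q.
    by rewrite ltrD2l (lt_trans _ q0)// oppr_lt0.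
  rewrite in_itv /= => /andP[h1 h2]; exists b; rewrite ltr_norml; lra.
exists a, b, q; split=> // w [hwa hwb]; apply: zU.
rewrite -ball_normE /=; apply: normc_lt => //.
have sq (x y c : R) : `|x - c| < ratr q -> `|y - c| < ratr q ->
    (x - y) ^+ 2 < (e0 / 2%:R) ^+ 2.
  move=> hx hy; rewrite -[ltLHS]real_normK ?num_real//.
  rewrite ltr_pXn2r ?nnegrE ?divr_ge0 ?(ltW e00)//.
  rewrite (_ : x - y = (x - c) - (y - c)); last by rewrite opprB addrA subrK.
  apply: (le_lt_trans (ler_normB _ _)); apply: (lt_le_trans (ltrD hx hy)).
  lra.
have := sq _ _ _ ha hwa; have := sq _ _ _ hb hwb.
case: z w {Uz ha hb hwa hwb} => [zr zi] [wr wi] /=; nra.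
Qed.

Lemma measurable_fun_complex d (T : measurableType d) (f : T -> R[i]) :
  measurable_fun setT (fun x => complex.Re (f x)) ->
  measurable_fun setT (fun x => complex.Im (f x)) ->
  measurable_fun setT f.
Proof.
move=> mRe mIm.
apply: (@measurability _ _ _ _ setT f (@open R[i])) => // _ [U oU <-].
rewrite setTI.
have -> : f @^-1` U = \bigcup_(a : rat) \bigcup_(b : rat) \bigcup_(e : rat)
    (if `[< box (ratr a) (ratr b) (ratr e) `<=` U >] then
       f @^-1` box (ratr a) (ratr b) (ratr e) else set0).
  apply/seteqP; split=> [x /= Ux|x [a _ [b _ [e _]]]].
    have [a [b [e [xB BU]]]] := open_box oU Ux.
    by exists a => //; exists b => //; exists e => //; rewrite asboolT.
  by case: asboolP => // BU /BU.
do 3 (apply: bigcupT_measurable_rat => ?).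
case: asboolP => // _.
have mnorm (g : T -> R) c r : measurable_fun setT g ->
    measurable [set x | `|g x - c| < r].
  move=> mg; have m : measurable_fun setT (fun x => `|g x - c|).
    by apply: measurableT_comp => //; exact: measurable_funB.
  rewrite -[X in measurable X]setTI.
  have := m measurableT `]-oo, r[%classic (measurable_itv _).
  by congr (measurable (_ `&` _)); apply/seteqP; split=> x /=; rewrite in_itv.
by apply: measurableI; exact: mnorm.
Qed.

End complex_borel.

Lemma measurable_invr (R : realType) : measurable_fun setT (@GRing.inv R).
Proof.
rewrite -(setvU [set (0 : R)]); apply/measurable_funU => //.
  exact: measurableC.
split; last exact: measurable_fun_set1.
apply: open_continuous_measurable_fun.
  by rewrite openC; exact: closed_eq.
by move=> x; rewrite inE /= => /eqP x0; exact: inv_continuous.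
Qed.

(* Lebesgue measure on R^n, as an iterated product. *)
Section lebesgue_tuple.
Context {R : realType}.

Definition tcons n (p : measurableTypeR R * n.-tuple R) : n.+1.-tuple R :=
  [tuple of p.1 :: p.2].

Lemma measurable_tcons n : measurable_fun setT (@tcons n).
Proof. exact: measurable_cons. Qed.

HB.instance Definition _ n :=
  isMeasurableFun.Build _ _ _ _ (@tcons n) (@measurable_tcons n).

Section lebesgue_cons.
Context n (m : {sigma_finite_measure set (n.-tuple R) -> \bar R}).

Definition lebesgue_cons : set (n.+1.-tuple R) -> \bar R :=
  pushforward (lebesgue_measure \x m)%E (@tcons n).

Let lebesgue_cons0 : lebesgue_cons set0 = 0%E.
Proof. exact: measure0. Qed.

Let lebesgue_cons_ge0 A : (0 <= lebesgue_cons A)%E.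
Proof. exact: measure_ge0. Qed.

Let lebesgue_cons_sigma_additive : semi_sigma_additive lebesgue_cons.
Proof. exact: measure_semi_sigma_additive. Qed.

HB.instance Definition _ := isMeasure.Build _ _ _ lebesgue_cons
  lebesgue_cons0 lebesgue_cons_ge0 lebesgue_cons_sigma_additive.

Let sigma_finite_lebesgue_cons : sigma_finite setT lebesgue_cons.
Proof.
have /sigma_finiteP[F [TF ndF Foo]] := sigma_finiteT (@lebesgue_measure R).
have /sigma_finiteP[G [TG ndG Goo]] := sigma_finiteT m.
pose u (t : n.+1.-tuple R) : R * n.-tuple R := (thead t, [tuple of behead t]).
have mu : measurable_fun setT u.
  by apply/measurable_fun_pairP; split;
    [exact: measurable_tnth | exact: measurable_behead].
have uK p : u (tcons p) = p.
  by case: p => x t; congr pair; apply/val_inj.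
exists (fun k => u @^-1` (F k `*` G k)).
  apply/seteqP; split=> // t _.
  have [k _ Fk] : (\bigcup_i F i) (u t).1 by rewrite -TF.
  have [l _ Gl] : (\bigcup_i G i) (u t).2 by rewrite -TG.
  exists (maxn k l) => //; split.
  - by move: Fk; exact/subsetPset/ndF/leq_maxl.
  - by move: Gl; exact/subsetPset/ndG/leq_maxr.
move=> k; have [mF Fk] := Foo k; have [mG Gk] := Goo k; split.
  by rewrite -[X in measurable X]setTI; apply: mu => //; exact: measurableX.
rewrite /lebesgue_cons /pushforward.
rewrite (_ : _ @^-1` _ = F k `*` G k); last first.
  by rewrite -comp_preimage (_ : u \o _ = id) //; exact/funext.
by rewrite product_measure1E// lte_mul_pinfty// ge0_fin_numE.
Qed.

HB.instance Definition _ :=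
  Measure_isSigmaFinite.Build _ _ _ lebesgue_cons sigma_finite_lebesgue_cons.

End lebesgue_cons.

Fixpoint lebesgue_tuple n : {sigma_finite_measure set (n.-tuple R) -> \bar R} :=
  match n with
  | 0 => \d_([tuple] : 0.-tuple R)
  | k.+1 => lebesgue_cons (lebesgue_tuple k)
  end.

End lebesgue_tuple.

Section sphere.
Context {R : realType} (n : nat).

Definition tuple_norm (t : n.-tuple R) : R :=
  Num.sqrt (\sum_(i < n) tnth t i ^+ 2).

Lemma measurable_tuple_norm : measurable_fun setT tuple_norm.
Proof.
apply: (@measurableT_comp _ _ _ _ _ _ (@Num.sqrt R)).
  by apply: continuous_measurable_fun; exact: sqrt_continuous.
apply: measurable_sum => i; apply: measurable_funX; exact: measurable_tnth.
Qed.

Definition punctured_ball : set (n.-tuple R) :=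
  [set t | 0 < tuple_norm t <= 1].

Lemma measurable_punctured_ball : measurable punctured_ball.
Proof.
rewrite -[X in measurable X]setTI.
have := measurable_tuple_norm measurableT (measurable_itv `]0, 1]).
by congr (measurable (_ `&` _)); apply/seteqP; split=> x /=; rewrite in_itv.
Qed.

Definition direction (t : n.-tuple R) : n.-tuple R :=
  [tuple tnth t i / tuple_norm t | i < n].

Lemma measurable_direction : measurable_fun setT direction.
Proof.
apply/measurable_fun_tnthP => i.
rewrite (_ : _ \o _ = fun t => tnth t i / tuple_norm t); last first.
  by apply/funext => t /=; rewrite tnth_mktuple.
apply: measurable_funM; first exact: measurable_tnth.
apply: (@measurableT_comp _ _ _ _ _ _ (@GRing.inv R)).
  exact: measurable_invr.
exact: measurable_tuple_norm.
Qed.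

HB.instance Definition _ :=
  isMeasurableFun.Build _ _ _ _ direction measurable_direction.

(* The Euclidean (surface) measure of a Borel part E of the unit sphere of R^n
   is n times the Lebesgue measure of the cone {x | 0 < |x| <= 1, x/|x| \in E};
   normalized to mass 1, it is the image by x |-> x/|x| of the normalized
   Lebesgue measure on the punctured unit ball.
   The Dirac mass is the default value of mnormalize, and only matters for
   n = 0, where the sphere is empty. *)
Definition sphere_measure : probability (n.-tuple R) R :=
  distribution
    (mnormalize (mrestr (lebesgue_tuple n) measurable_punctured_ball)
                (\d_([tuple 0 | i < n] : n.-tuple R)))
    direction.

End sphere.

Section numerical_measure.
Context {R : realType}.

(* The inner product <x, y> = y^* x and the Euclidean norm on C^n. *)
Definition inner n (x y : 'cV[R[i]]_n) : R[i] :=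
  \sum_(i < n) x i 0 * (y i 0)^*%R.

Definition enorm n (x : 'cV[R[i]]_n) : R :=
  Num.sqrt (complex.Re (inner x x)).

Definition op_norm n (A : 'M[R[i]]_n) : R :=
  sup [set enorm (A *m x) | x in [set x : 'cV[R[i]]_n | enorm x = 1]].

(* The identification of R^(2n) with C^n. *)
Definition cvec n (t : (n + n).-tuple R) : 'cV[R[i]]_n :=
  \col_(i < n) (tnth t (lshift n i) +i* tnth t (rshift n i)).

Lemma enorm_cvec n (t : (n + n).-tuple R) : enorm (cvec t) = tuple_norm t.
Proof.
rewrite /enorm /tuple_norm /inner big_split_ord /= raddf_sum /= -big_split /=.
congr Num.sqrt; apply: eq_bigr => i _; rewrite !mxE /=.
by rewrite mulrN opprK !expr2.
Qed.

Definition quad_form n (A : 'M[R[i]]_n) (t : (n + n).-tuple R) : R[i] :=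
  inner (A *m cvec t) (cvec t).

Lemma measurable_quad_form n (A : 'M[R[i]]_n) :
  measurable_fun setT (quad_form A).
Proof.
pose mC (T := (n + n).-tuple R) (f : T -> R[i]) :=
  measurable_fun setT (fun x => complex.Re (f x)) /\
  measurable_fun setT (fun x => complex.Im (f x)).
have mM f g : mC f -> mC g -> mC (fun t => f t * g t).
  move=> [f1 f2] [g1 g2]; split.
    rewrite (_ : (fun _ => _) = (fun x => complex.Re (f x) * complex.Re (g x)
       - complex.Im (f x) * complex.Im (g x))); last first.
      by apply/funext => x; case: (f x) (g x) => a b [c d].
    by apply: measurable_funB; exact: measurable_funM.
  rewrite (_ : (fun _ => _) = (fun x => complex.Re (f x) * complex.Im (g x)
       + complex.Im (f x) * complex.Re (g x))); last first.
    by apply/funext => x; case: (f x) (g x) => a b [c d].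
  by apply: measurable_funD; exact: measurable_funM.
have mS (F : 'I_n -> (n + n).-tuple R -> R[i]) :
    (forall i, mC (F i)) -> mC (fun t => \sum_(i < n) F i t).
  move=> mF; split.
    rewrite (_ : (fun _ => _) = (fun t => \sum_(i < n) complex.Re (F i t))).
      by apply: measurable_sum => i; case: (mF i).
    by apply/funext => t; rewrite raddf_sum.
  rewrite (_ : (fun _ => _) = (fun t => \sum_(i < n) complex.Im (F i t))).
    by apply: measurable_sum => i; case: (mF i).
  by apply/funext => t; rewrite raddf_sum.
have mx i : mC (fun t => cvec t i 0).
  split; [rewrite (_ : (fun _ => _) = fun t => tnth t (lshift n i)) |
          rewrite (_ : (fun _ => _) = fun t => tnth t (rshift n i))];
  by [exact: measurable_tnth | apply/funext => t; rewrite mxE].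
suff [? ?] : mC (quad_form A) by exact: measurable_fun_complex.
apply: (mS) => i; apply: (mM).
  rewrite (_ : (fun _ => _) = fun t => \sum_(j < n) A i j * cvec t j 0).
    by apply: (mS) => j; apply: (mM) => //; split; exact: measurable_cst.
  by apply/funext => t; rewrite mxE.
have [m1 m2] := mx i; split.
  rewrite (_ : (fun _ => _) = fun t => complex.Re (cvec t i 0)) //.
  by apply/funext => t; case: (cvec t i 0).
rewrite (_ : (fun _ => _) = fun t => - complex.Im (cvec t i 0)).
  exact: measurable_funN.
by apply/funext => t; case: (cvec t i 0).
Qed.

HB.instance Definition _ n (A : 'M[R[i]]_n) :=
  isMeasurableFun.Build _ _ _ _ (quad_form A) (measurable_quad_form A).

Definition numerical_measure n (A : 'M[R[i]]_n) : probability R[i] R :=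
  distribution (sphere_measure (n + n)) (quad_form A).

Definition first_moment (mu : probability R[i] R) : R[i] :=
  (\int[mu]_z complex.Re z)%R +i* (\int[mu]_z complex.Im z)%R.

(* Weak convergence to 0 of the signed measures mu n - nu n, with test functions
   the bounded uniformly continuous ones; the integral of f with respect to
   mu n - nu n is the difference of the two integrals.  This class contains
   C_0(C), hence this convergence implies the weak-* one in the dual of C_0(C),
   and it is the usual weak convergence when nu is a constant sequence of
   probability measures.  All bounded continuous functions cannot be allowed
   when the masses may escape to infinity: uniform measures on circles of
   center k and radius 4^-k, minus Dirac masses at k, would not converge
   to 0. *)
Definition diff_weakly_cvg0 (mu nu : nat -> probability R[i] R) : Prop :=
  forall f : R[i] -> R,
    (exists M : R, forall z, `|f z| <= M) -> unif_continuous f ->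
    (fun n => (\int[mu n]_z f z - \int[nu n]_z f z)%R) @ \oo --> (0 : R).

End numerical_measure.

(* Main.v *)
From HB Require Import structures.
Require Import Defs.
From mathcomp Require Import all_boot all_order all_algebra.
From mathcomp Require Import all_classical all_reals all_analysis.
From mathcomp Require Import measurable_realfun complex ring lra.
Import Order.TTheory GRing.Theory Num.Theory numFieldNormedType.Exports.
Local Open Scope classical_set_scope.
Local Open Scope ring_scope.

(* Identify the unit sphere of C^n with that of R^m, m = 2n.  Lebesgue measure
   on R^m is invariant under adding to one coordinate a function of the others
   (Fubini and translation invariance), hence under plane rotations, which are
   products of three shears; so the sphere measure is rotation invariant.
   Invariance under half-turns, quarter-turns and the rotation of cosine 3/5,
   together with |t| = 1, determines the fourth moments:
     E[t_i t_j t_k t_l] = (d_ij d_kl + d_ik d_jl + d_il d_jk) / (m (m + 2)).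
   Hence a quadratic form of matrix B has variance at most
   2 |B|_HS^2 / (m (m + 2)).  For the real and imaginary parts of <Ax, x>, the
   rows of B have norm at most ||A||, so each variance is at most ||A||^2 / n.
   If f is bounded by M and |f z - f w| < e / 2 whenever |z - w| < d, then
   |f z - f w| <= e / 2 + 2 M |z - w|^2 / d^2 everywhere; integrate this at the
   mean w. *)

(** * Invariance of Lebesgue measure under translations and shears *)

Lemma lebesgue_measure_translation (R : realType) (c : R) (E : set R) :
  measurable E ->
  lebesgue_measure ((fun x => x + c) @^-1` E) = lebesgue_measure E.
Proof.
move=> mE; apply/esym.
pose shift (x : measurableTypeR R) : measurableTypeR R := x + c.
have mshift : measurable_fun setT shift by exact: measurable_funD.
pose f : {mfun measurableTypeR R >-> measurableTypeR R} :=
  HB.pack shift (isMeasurableFun.Build _ _ _ _ _ mshift).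
(* Lebesgue measure is determined by its values on half-open intervals, so it suffices to compute
   the length of a translated one. *)
rewrite (@lebesgue_measure_unique R (pushforward lebesgue_measure f))//.
move=> _ [[a b] /= _ <-]; rewrite /= /pushforward lebesgue_measure_itv/=.
rewrite (_ : _ @^-1` _ = `]a - c, b - c]%classic); last first.
  by apply/seteqP; split=> x /=; rewrite !in_itv /= ltrBlDr lerBrDr.
rewrite lebesgue_measure_itv /= !lte_fin ltrD2r.
by case: ifP => // _; rewrite -!EFinB; congr EFin; ring.
Qed.

Section shear.
Set Implicit Arguments.
Unset Strict Implicit.
Context {R : realType}.

Definition tadd n (i : 'I_n) (g : n.-tuple R -> R) (t : n.-tuple R) :=
  [tuple tnth t k + (if k == i then g t else 0) | k < n].

Lemma measurable_tadd n (i : 'I_n) g : measurable_fun setT g ->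
  measurable_fun setT (tadd i g).
Proof.
move=> mg; apply/measurable_fun_tnthP => k.
rewrite (_ : _ \o _ = fun t => tnth t k + (if k == i then g t else 0));
  last first.
  by apply/funext => t /=; rewrite tnth_mktuple.
by apply: measurable_funD; [exact: measurable_tnth|case: (k == i)].
Qed.

(** The second hypothesis says that [g] does not depend on coordinate [i], so [tadd i g] is a shear.
    By induction on [n]: if [i] is not the head, the shear acts on the tail for each fixed head and
    the induction hypothesis applies to the slices; if [i] is the head, it is a translation of the
    head for each fixed tail. *)
Lemma lebesgue_tuple_tadd n (i : 'I_n) (g : n.-tuple R -> R) :
  measurable_fun setT g -> (forall t x, g (tadd i (cst x) t) = g t) ->
  forall E, measurable E ->
  lebesgue_tuple n (tadd i g @^-1` E) = lebesgue_tuple n E.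
Proof.
elim: n i g => [[]//|n IH] i g mg gi E mE.
have mF : measurable (@tcons R n @^-1` E).
  by rewrite -[X in measurable X]setTI; exact: measurable_tcons.
have mtE : measurable (tadd i g @^-1` E).
  by rewrite -[X in measurable X]setTI; exact: measurable_tadd.
have mtF : measurable (@tcons R n @^-1` (tadd i g @^-1` E)).
  by rewrite -[X in measurable X]setTI; exact: measurable_tcons.
rewrite /= /lebesgue_cons /pushforward.
case: (unliftP ord0 i) => [k|] ik.
  apply: eq_integral => s _ /=.
  have mgs : measurable_fun setT (fun u => g (tcons (s, u))).
    apply: (measurableT_comp mg).
    apply: (measurableT_comp (@measurable_tcons R n)).
    exact: measurable_pair1.
  have tcadd h u : tadd i h (tcons (s, u)) =
      tcons (s, tadd k (fun u => h (tcons (s, u))) u).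
    apply: eq_from_tnth => l; rewrite tnth_mktuple.
    case: (unliftP ord0 l) => [j|] ->.
      by rewrite !tnthS tnth_mktuple ik (inj_eq lift_inj).
    by rewrite !tnth0 ik eq_liftF addr0.
  rewrite -[RHS](IH k (fun u => g (tcons (s, u)))) //.
  - by congr (_ _); apply/seteqP; split=> u; rewrite /xsection /= !inE /= tcadd.
  - by move=> v x; rewrite -(tcadd (cst x)) gi.
  - exact: measurable_xsection.
rewrite /product_measure1.
(* The product measure integrates over the head last; [slices] exchanges the order, so that the head
   becomes the inner variable. *)
have slices (F : set (measurableTypeR R * n.-tuple R)) : measurable F ->
    (lebesgue_measure \x lebesgue_tuple n)%E F =
    (\int[lebesgue_tuple n]_y lebesgue_measure (ysection F y))%E.
  move=> mF'; apply: (product_measure_unique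
    (m' := (lebesgue_measure \x^ lebesgue_tuple n)%E)) => // A B mA mB.
  exact: product_measure2E.
have := slices _ mF; have := slices _ mtF; rewrite /product_measure1 => -> ->.
apply: eq_integral => u _.
(* Shifting the head by [- s] leaves [g] unchanged, so the amount of the translation depends on the
   tail [u] only. *)
have gs s : g (tcons (s, u)) = g (tcons (0, u)).
  rewrite -(gi _ (-s)); congr g; apply: eq_from_tnth => l;
    rewrite tnth_mktuple ik.
  case: (unliftP ord0 l) => [j|] ->; first by rewrite !tnthS eq_sym eq_liftF
    addr0.
  by rewrite !tnth0 eqxx subrr.
have tE s : tadd i g (tcons (s, u)) = tcons (s + g (tcons (0, u)), u).
  apply: eq_from_tnth => l; rewrite tnth_mktuple ik.
  case: (unliftP ord0 l) => [j|] ->; first by rewrite !tnthS eq_sym eq_liftF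
    addr0.
  by rewrite !tnth0 eqxx gs.
rewrite -[RHS](@lebesgue_measure_translation R (g (tcons (0, u)))); last first.
  exact: measurable_ysection.
by congr (_ _); apply/seteqP; split=> s; rewrite /ysection /= !inE /= tE.
Qed.

End shear.

(** * Plane rotations as products of shears *)

Section rotation.
Set Implicit Arguments.
Unset Strict Implicit.
Context {R : realType}.

Definition plane_rot n (i j : 'I_n) (c s : R) (t : n.-tuple R) : n.-tuple R :=
  [tuple if k == i then c * tnth t i - s * tnth t j
         else if k == j then s * tnth t i + c * tnth t j
         else tnth t k | k < n].

(** For [c = cos a] and [s = sin a], the coefficient [(c - 1) / s] is [- tan (a / 2)], which is why
    [s] must be nonzero. *)
Lemma plane_rot_tadd n (i j : 'I_n) (c s : R) : i != j -> s != 0 ->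
  c ^+ 2 + s ^+ 2 = 1 ->
  plane_rot i j c s = tadd i (fun t => (c - 1) / s * tnth t j)
    \o (tadd j (fun t => s * tnth t i)
    \o tadd i (fun t => (c - 1) / s * tnth t j)).
Proof.
move=> ij s0 cs; apply/funext => t; apply: eq_from_tnth => k /=.
have c2 : c ^+ 2 = 1 - s ^+ 2 by rewrite -cs addrK.
have [ij0 ji0] : (i == j) = false /\ (j == i) = false by rewrite [j == i]eq_sym
  (negbTE ij).
rewrite !(tnth_mktuple, eqxx, ij0, ji0, addr0).
have [->|ki] := eqVneq k i.
  rewrite ij0 addr0; apply/eqP; rewrite -subr_eq0.
  rewrite (_ : _ - _ = (1 - c ^+ 2 - s ^+ 2) / s * tnth t j); last by field.
  by rewrite c2; apply/eqP; ring.
rewrite addr0; case: eqP => [->|_]; last by rewrite !addr0.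
by rewrite addr0; field.
Qed.

Lemma measurable_plane_rot n (i j : 'I_n) (c s : R) :
  measurable_fun setT (plane_rot i j c s).
Proof.
apply/measurable_fun_tnthP => k.
rewrite (_ : _ \o _ = fun t => if k == i then c * tnth t i - s * tnth t j
         else if k == j then s * tnth t i + c * tnth t j
         else tnth t k); last first.
  by apply/funext => t /=; rewrite tnth_mktuple.
have mM (a : R) l : measurable_fun setT (fun t : n.-tuple R => a * tnth t l).
  by apply: measurable_funM => //; exact: measurable_tnth.
case: (k == i); first exact: measurable_funB.
by case: (k == j); [exact: measurable_funD|exact: measurable_tnth].
Qed.

Lemma lebesgue_tuple_plane_rot n (i j : 'I_n) (c s : R) : i != j -> s != 0 ->
  c ^+ 2 + s ^+ 2 = 1 -> forall E, measurable E ->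
  lebesgue_tuple n (plane_rot i j c s @^-1` E) = lebesgue_tuple n E.
Proof.
move=> ij s0 cs E mE; rewrite plane_rot_tadd// !comp_preimage.
have shear k l (a : R) : k != l -> forall F, measurable F ->
    measurable (tadd k (fun t => a * tnth t l) @^-1` F) /\
    lebesgue_tuple n (tadd k (fun t => a * tnth t l) @^-1` F) =
    lebesgue_tuple n F.
  move=> kl F mF.
  have mg : measurable_fun setT (fun t : n.-tuple R => a * tnth t l).
    by apply: measurable_funM => //; exact: measurable_tnth.
  split; first by rewrite -[X in measurable X]setTI; exact: measurable_tadd.
  apply: lebesgue_tuple_tadd => // t x.
  by rewrite tnth_mktuple [l == k]eq_sym (negbTE kl) addr0.
have [m1 e1] := shear i j ((c - 1) / s) ij E mE.
have ji : j != i by rewrite eq_sym.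
have [m2 e2] := shear j i s ji _ m1.
by have [_ ->] := shear i j ((c - 1) / s) ij _ m2; rewrite e2 e1.
Qed.

Lemma tuple_norm_sq n (t : n.-tuple R) :
  tuple_norm t ^+ 2 = \sum_(k < n) tnth t k ^+ 2.
Proof. by rewrite sqr_sqrtr// sumr_ge0// => k _; exact: sqr_ge0. Qed.

Lemma tuple_norm_plane_rot n (i j : 'I_n) (c s : R) (t : n.-tuple R) : i != j ->
  c ^+ 2 + s ^+ 2 = 1 -> tuple_norm (plane_rot i j c s t) = tuple_norm t.
Proof.
move=> ij cs; have c2 : c ^+ 2 = 1 - s ^+ 2 by rewrite -cs addrK.
have ji : j != i by rewrite eq_sym.
congr Num.sqrt; rewrite [LHS](bigD1 i)//= [RHS](bigD1 i)//=.
rewrite [X in _ + X = _](bigD1 j)//= [X in _ = _ + X](bigD1 j)//=.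
rewrite !tnth_mktuple eqxx eq_sym (negbTE ij) eqxx !addrA; congr (_ + _).
  apply/eqP; rewrite -subr_eq0.
  rewrite (_ : _ - _ = (c ^+ 2 + s ^+ 2 - 1) * (tnth t i ^+ 2 + tnth t j ^+ 2)).
    by rewrite cs subrr mul0r.
  by ring.
apply: eq_bigr => k /andP[ki kj].
by rewrite tnth_mktuple (negbTE ki) (negbTE kj).
Qed.

(** A rotation is linear and preserves the norm, hence commutes with radial projection; this carries
    invariance from the ball to the sphere. *)
Lemma direction_plane_rot n (i j : 'I_n) (c s : R) (t : n.-tuple R) : i != j ->
  c ^+ 2 + s ^+ 2 = 1 ->
  direction (plane_rot i j c s t) = plane_rot i j c s (direction t).
Proof.
move=> ij cs; apply: eq_from_tnth => k.
rewrite !tnth_mktuple tuple_norm_plane_rot//.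
by case: (k == i); [rewrite mulrBl !mulrA|case: (k == j);
  rewrite ?mulrDl ?mulrA].
Qed.

End rotation.

(** * Rotation invariance and support of the sphere measure *)

Section sphere_measure.
Set Implicit Arguments.
Unset Strict Implicit.
Context {R : realType}.

Lemma lebesgue_tuple_box n (a b : R) : a <= b ->
  measurable [set t : n.-tuple R | forall i, a <= tnth t i <= b] /\
  lebesgue_tuple n [set t : n.-tuple R | forall i, a <= tnth t i <= b] =
  ((b - a) ^+ n)%:E.
Proof.
move=> ab; elim: n => [|n [mB IH]].
  rewrite (_ : [set _ | _] = setT); last by apply/seteqP; split=> // t _ [].
  by split=> //; rewrite /= diracT.
split.
  rewrite (_ : [set _ | _] = \bigcap_(i in [set: 'I_n.+1])
      ((fun t : n.+1.-tuple R => tnth t i) @^-1` `[a, b]%classic)).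
    apply: fin_bigcap_measurable => // i _; rewrite -[X in measurable X]setTI.
    exact: measurable_tnth.
  apply/seteqP; split=> t /= h i; first by move=> _; rewrite /= in_itv /= h.
  by have := h i I; rewrite /= in_itv.
rewrite /= /lebesgue_cons /pushforward.
rewrite (_ : _ @^-1` _ =
    `[a, b]%classic `*` [set t : n.-tuple R | forall i, a <= tnth t i <= b]).
  rewrite product_measure1E// [X in (_ * X)%E]IH /= lebesgue_measure_itv /=
    lte_fin.
  have [_|] := ltP a b; first by rewrite -EFinB -EFinM exprS.
  by move=> ba; have -> : b = a; [exact/le_anti/andP|rewrite subrr mul0e exprS
    mul0r].
apply/seteqP; split=> [[s t]/= h|[s t] /= [sab h] i].
  split; first by have := h ord0; rewrite tnth0 in_itv.
  by move=> i; have := h (lift ord0 i); rewrite tnthS.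
by case: (unliftP ord0 i) => [k|] ->; rewrite ?tnthS ?tnth0 //; move: sab;
  rewrite in_itv.
Qed.

(** The punctured ball contains a small cube away from the origin and lies in the cube of side 2.
    With a mass neither zero nor infinite, [mnormalize] does divide by it instead of returning its
    default. *)
Lemma lebesgue_punctured_ball n : (0 < n)%N ->
  (0 < lebesgue_tuple n (@punctured_ball R n) < +oo)%E.
Proof.
move=> n0; have mball := @measurable_punctured_ball R n; apply/andP; split.
  (* Since [b <= 1], each squared coordinate of a point of the cube [[b / 2, b]^n] is at most [b],
     and the [n] of them sum to at most 1. *)
  pose b : R := n%:R^-1; have n0' : 0 < n%:R :> R by rewrite ltr0n.
  have b0 : 0 < b by rewrite invr_gt0.
  have [mB B] := @lebesgue_tuple_box n (b / 2) b ltac:(lra).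
  apply: (@lt_le_trans _ _ (lebesgue_tuple n
      [set t : n.-tuple R | forall i, b / 2 <= tnth t i <= b])).
    by rewrite [ltRHS]B lte_fin exprn_gt0//; lra.
  apply: le_measure; rewrite ?inE// => t /= h; apply/andP; split.
    rewrite sqrtr_gt0 (bigD1 (Ordinal n0))//= ltr_pwDl//.
      by rewrite exprn_gt0//; have /andP[] := h (Ordinal n0); lra.
    by apply: sumr_ge0 => k _; exact: sqr_ge0.
  rewrite -[leRHS]sqrtr1 ler_sqrt//.
  apply: (@le_trans _ _ (\sum_(k < n) b)).
    apply: ler_sum => k _; have /andP[h1 h2] := h k.
    have b1 : b <= 1 by rewrite invf_le1// ler1n.
    by nra.
  by rewrite sumr_const card_ord -mulr_natr mulVf// gt_eqF.
have [mB B] := @lebesgue_tuple_box n (-1) 1 ltac:(lra).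
apply: (@le_lt_trans _ _ (lebesgue_tuple n
    [set t : n.-tuple R | forall i, -1 <= tnth t i <= 1])); last first.
  by rewrite [ltLHS]B ltry.
apply: le_measure; rewrite ?inE// => t /= /andP[_ h] i.
rewrite -ler_norml -sqrtr_sqr; apply: le_trans h.
rewrite ler_sqrt; last by apply: sumr_ge0 => k _; exact: sqr_ge0.
by rewrite (bigD1 i)//= lerDl; apply: sumr_ge0 => k _; exact: sqr_ge0.
Qed.

Lemma sphere_measureE n (E : set (n.-tuple R)) : (0 < n)%N ->
  sphere_measure n E =
  (lebesgue_tuple n (@direction R n @^-1` E `&` @punctured_ball R n) *
   (fine (lebesgue_tuple n (@punctured_ball R n)))^-1%:E)%E.
Proof.
move=> /lebesgue_punctured_ball/andP[b0 boo].
rewrite /sphere_measure /distribution /pushforward /= /mnormalize /= /mrestr.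
by rewrite setTI gt_eqF// lt_eqF.
Qed.

(** The cone over a rotated set is the rotated cone, and the punctured ball is preserved, so the
    invariance of Lebesgue measure applies. *)
Lemma sphere_measure_plane_rot n (i j : 'I_n) (c s : R) : i != j -> s != 0 ->
  c ^+ 2 + s ^+ 2 = 1 -> forall E, measurable E ->
  sphere_measure n (plane_rot i j c s @^-1` E) = sphere_measure n E.
Proof.
move=> ij s0 cs E mE.
have n0 : (0 < n)%N by case: n i {j E mE ij} => // -[].
rewrite !sphere_measureE//; congr (_ * _)%E.
rewrite -[RHS](@lebesgue_tuple_plane_rot _ n i j c s)//.
  congr (_ _); apply/seteqP; split=> t /=;
  by rewrite /punctured_ball/= direction_plane_rot// tuple_norm_plane_rot.
apply: measurableI; last exact: measurable_punctured_ball.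
by rewrite -[X in measurable X]setTI; exact: measurable_direction.
Qed.

Lemma sphere_measure_sphere n : (0 < n)%N ->
  sphere_measure n [set t : n.-tuple R | \sum_(k < n) tnth t k ^+ 2 != 1] = 0%E.
Proof.
move=> n0; rewrite sphere_measureE// (_ : _ `&` _ = set0) ?measure0 ?mul0e//.
apply/seteqP; split=> // t [/= /eqP h /andP[t0 _]]; apply: h.
under eq_bigr do rewrite tnth_mktuple expr_div_n.
by rewrite -mulr_suml -tuple_norm_sq mulfV// expf_neq0// gt_eqF.
Qed.

(** At the origin the quotient by the zero norm is 0, so the bound holds for every [t]. *)
Lemma direction_le1 n (t : n.-tuple R) i : `|tnth (direction t) i| <= 1.
Proof.
rewrite tnth_mktuple normrM normfV [X in _ / X]ger0_norm ?sqrtr_ge0//.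
have [->|t0] := eqVneq (tuple_norm t) 0; first by rewrite invr0 mulr0.
rewrite ler_pdivrMr ?lt_neqAle 1?eq_sym ?t0 ?sqrtr_ge0// mul1r -sqrtr_sqr.
rewrite ler_sqrt; last by apply: sumr_ge0 => k _; exact: sqr_ge0.
by rewrite (bigD1 i)//= lerDl; apply: sumr_ge0 => k _; exact: sqr_ge0.
Qed.

End sphere_measure.

(** * Expectations on the sphere *)

Section sphere_expectation.
Set Implicit Arguments.
Unset Strict Implicit.
Context {R : realType} (n : nat).
Implicit Types (F G : n.-tuple R -> R) (t : n.-tuple R).

(* The range of [direction] carries [sphere_measure]; unlike on the whole space,
   polynomials are bounded there. *)
Definition sphere_bounded G :=
  measurable_fun setT G /\ exists M, forall t, `|G (direction t)| <= M.

Lemma sphere_bounded_cst c : sphere_bounded (fun=> c).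
Proof. by split=> //; exists `|c|. Qed.

Lemma sphere_bounded_coord i : sphere_bounded (fun t => tnth t i).
Proof.
by split; [exact: measurable_tnth|exists 1 => t; exact: direction_le1].
Qed.

Lemma sphere_boundedD F G : sphere_bounded F -> sphere_bounded G ->
  sphere_bounded (fun t => F t + G t).
Proof.
move=> [mF [M FM]] [mG [N GN]]; split; first exact: measurable_funD.
by exists (M + N) => t; apply: (le_trans (ler_normD _ _)); exact: lerD.
Qed.

Lemma sphere_boundedM F G : sphere_bounded F -> sphere_bounded G ->
  sphere_bounded (fun t => F t * G t).
Proof.
move=> [mF [M FM]] [mG [N GN]]; split; first exact: measurable_funM.
by exists (M * N) => t; rewrite normrM; exact: ler_pM.
Qed.

Lemma sphere_bounded_sum (I : finType) (F : I -> n.-tuple R -> R) :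
  (forall i, sphere_bounded (F i)) ->
  sphere_bounded (fun t => \sum_i F i t).
Proof.
move=> bF; rewrite unlock; elim: (index_enum I) => [|i s IH] /=.
  exact: sphere_bounded_cst.
exact: sphere_boundedD.
Qed.

(** Integrating [G] against an image measure amounts to integrating [G \o direction], which is
    bounded, against a finite measure. *)
Lemma sphere_bounded_integrable G : sphere_bounded G ->
  (sphere_measure n).-integrable setT (EFin \o G).
Proof.
move=> [mG [M GM]]; rewrite /sphere_measure /distribution.
apply: integrable_pushforward => //; first exact/measurable_EFinP.
apply: (@measurable_bounded_integrable _ _ _ _ (G \o direction (n:=n))) => //.
- by rewrite preimage_setT.
- apply: (@le_lt_trans _ _ (@sphere_measure R n setT)) => //.
  by rewrite probability_setT ltry.
- rewrite preimage_setT.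
  exact: (measurableT_comp mG (@measurable_direction R n)).
- by exists M; split; [exact: num_real|move=> x Mx t _ /=;
  exact: le_trans (GM t) (ltW Mx)].
Qed.

Definition sphere_exp G := \int[@sphere_measure R n]_t G t.

Lemma sphere_expD F G : sphere_bounded F -> sphere_bounded G ->
  sphere_exp (fun t => F t + G t) = sphere_exp F + sphere_exp G.
Proof. by move=> *; apply: RintegralD => //; exact: sphere_bounded_integrable.
  Qed.

Lemma sphere_expZ c G : sphere_bounded G ->
  sphere_exp (fun t => c * G t) = c * sphere_exp G.
Proof. by move=> *; apply: RintegralZl => //; exact: sphere_bounded_integrable.
  Qed.

Lemma sphere_exp_cst c : sphere_exp (fun=> c) = c.
Proof.
rewrite /sphere_exp Rintegral_cst//= (_ : fine _ = fine 1%E) ?mulr1//.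
by congr fine; exact: (@probability_setT _ _ _ (sphere_measure n)).
Qed.

Lemma sphere_exp_sum (I : finType) (F : I -> n.-tuple R -> R) :
  (forall i, sphere_bounded (F i)) ->
  sphere_exp (fun t => \sum_i F i t) = \sum_i sphere_exp (F i).
Proof.
move=> bF; rewrite unlock; elim: (index_enum I) => [|i s IH] /=.
  exact: sphere_exp_cst.
rewrite sphere_expD ?IH//; elim: {IH} s => [|j s IH] /=.
  exact: sphere_bounded_cst.
exact: sphere_boundedD.
Qed.

Lemma sphere_exp_plane_rot (i j : 'I_n) (c s : R) G : i != j -> s != 0 ->
  c ^+ 2 + s ^+ 2 = 1 -> sphere_bounded G ->
  sphere_exp (fun t => G (plane_rot i j c s t)) = sphere_exp G.
Proof.
move=> ij s0 cs [mG [M GM]].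
have bGr : sphere_bounded (fun t => G (plane_rot i j c s t)).
  split; first by apply: measurableT_comp => //; exact: measurable_plane_rot.
  (* A rotated direction is again a direction, so the bound on [G] still applies. *)
  by exists M => t; rewrite -direction_plane_rot.
have := sphere_bounded_integrable bGr => iGr; congr fine.
have mr := @measurable_plane_rot R n i j c s.
have := @integral_pushforward _ _ _ _ R _ mr (@sphere_measure R n) setT (EFin
  \o G).
rewrite preimage_setT => /(_ _ _ measurableT) <- //;
  last exact/measurable_EFinP.
apply: eq_measure_integral => A mA _; exact: sphere_measure_plane_rot.
Qed.

(** The two integrands agree where [|t| = 1], that is, off a null set. This links the moments of
    degrees 0, 2 and 4. *)
Lemma sphere_exp_sphere G : (0 < n)%N -> sphere_bounded G ->
  sphere_exp (fun t => G t * \sum_(k < n) tnth t k ^+ 2) = sphere_exp G.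
Proof.
move=> n0 bG; congr fine.
have bS : sphere_bounded (fun t => \sum_(k < n) tnth t k ^+ 2).
  apply: sphere_bounded_sum => k.
  by apply: sphere_boundedM; exact: sphere_bounded_coord.
have [mS _] := bS.
apply: ae_eq_integral => //.
- by apply/measurable_EFinP; have [] := sphere_boundedM bG bS.
- by apply/measurable_EFinP; case: bG.
exists [set t : n.-tuple R | \sum_(k < n) tnth t k ^+ 2 != 1]; split.
- rewrite -[X in measurable X]setTI.
  have := mS measurableT (~` [set 1]) (measurableC (measurable_set1 1)).
  by congr (measurable (_ `&` _)); apply/seteqP; split=> t /= /eqP.
- exact: sphere_measure_sphere.
- move=> t /= h; apply/eqP => t1; apply: h => _; by rewrite t1 mulr1.
Qed.

End sphere_expectation.

(** * Moments of order 2 and 4, and variance of quadratic forms *)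

Section sphere_moments.
Set Implicit Arguments.
Unset Strict Implicit.
Context {R : realType} (n : nat).
Hypothesis n4 : (4 < n)%N.

Let n0 : (0 < n)%N. Proof. exact: leq_trans n4. Qed.

Definition moment4 (i j k l : 'I_n) : R :=
  sphere_exp (fun t => tnth t i * tnth t j * (tnth t k * tnth t l)).

Let bT (i : 'I_n) := @sphere_bounded_coord R n i.
Let bM2 (i j : 'I_n) := sphere_boundedM (bT i) (bT j).
Let bM4 (i j k l : 'I_n) := sphere_boundedM (bM2 i j) (bM2 k l).

(** These three adjacent transpositions generate all permutations of the four indices. *)
Lemma moment4_12 i j k l : moment4 i j k l = moment4 j i k l.
Proof. by congr sphere_exp; apply/funext => t; ring. Qed.

Lemma moment4_23 i j k l : moment4 i j k l = moment4 i k j l.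
Proof. by congr sphere_exp; apply/funext => t; ring. Qed.

Lemma moment4_34 i j k l : moment4 i j k l = moment4 i j l k.
Proof. by congr sphere_exp; apply/funext => t; ring. Qed.

(* A half-turn in the plane of i and of a coordinate absent from the monomial
   (whence 4 < n) changes its sign. *)
Lemma moment4_single i j k l : i != j -> i != k -> i != l ->
  moment4 i j k l = 0.
Proof.
move=> ij ik il.
have [q] : exists q, q \notin [:: i; j; k; l].
  apply/existsP; rewrite -negb_forall; apply/negP => /forallP h.
  have : (#|'I_n| <= size [:: i; j; k; l])%N.
    by rewrite -(eq_card h); exact: card_size.
  by rewrite card_ord leqNgt n4.
rewrite !inE !negb_or => /and4P[qi qj qk ql].
have iq : i != q by rewrite eq_sym.
have c0 : (0 : R) ^+ 2 + 1 ^+ 2 = 1 by ring.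
pose r := @plane_rot R n i q 0 1.
have bG := bM4 i j k l.
have bGr : sphere_bounded (fun t : n.-tuple R => tnth (r t) i * tnth (r t) j *
  (tnth (r t) k * tnth (r t) l)).
  have [mG [M GM]] := bG; split.
    exact: (measurableT_comp mG (@measurable_plane_rot R n i q 0 1)).
  by exists M => t; rewrite /r -direction_plane_rot.
have := sphere_exp_plane_rot iq (oner_neq0 R) c0 bGr.
rewrite (sphere_exp_plane_rot iq (oner_neq0 R) c0 bG) -/(moment4 i j k l).
rewrite (_ : (fun _ => _) = (fun t => -1 * (tnth t i * tnth t j * (tnth t k *
  tnth t l)))).
  by rewrite sphere_expZ// -/(moment4 i j k l) mulN1r => h; lra.
apply/funext => t; rewrite !tnth_mktuple !eqxx ![_ == i]eq_sym (negbTE ij)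
  (negbTE ik) (negbTE il) (negbTE iq).
rewrite ![_ == q]eq_sym (negbTE qj) (negbTE qk) (negbTE ql); ring.
Qed.

(** The quarter-turn in the plane of [i] and [k] puts coordinate [i] in place [k]. *)
Lemma moment4_diag i k : moment4 i i i i = moment4 k k k k.
Proof.
have [->//|ik] := eqVneq i k.
have c0 : (0 : R) ^+ 2 + 1 ^+ 2 = 1 by ring.
have := sphere_exp_plane_rot ik (oner_neq0 R) c0 (bM4 k k k k).
rewrite -/(moment4 k k k k) => <-; congr sphere_exp; apply/funext => t.
by rewrite !tnth_mktuple eqxx eq_sym (negbTE ik) mul0r mul1r addr0.
Qed.

(* Expand invariance under the rotation of cosine 3/5 and sine 4/5; any rotation
   that is not a multiple of a quarter-turn would do. *)
Lemma moment4_pair i k : i != k -> moment4 i i i i = 3 * moment4 i i k k.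
Proof.
move=> ik; have ki : k != i by rewrite eq_sym.
have s0 : 4 / 5 != 0 :> R by apply: lt0r_neq0; lra.
have cs : (3 / 5 : R) ^+ 2 + (4 / 5) ^+ 2 = 1 by field.
have := sphere_exp_plane_rot ik s0 cs (bM4 i i i i).
pose m := fun (i j k l : 'I_n) (t : n.-tuple R) =>
  tnth t i * tnth t j * (tnth t k * tnth t l).
have bm c i' j' k' l' : sphere_bounded (fun t => c * m i' j' k' l' t).
  by apply: sphere_boundedM; [exact: sphere_bounded_cst|exact: bM4].
rewrite (_ : (fun _ => _) = (fun t => (3 / 5) ^+ 4 * m i i i i t +
   (- 4 * (3 / 5) ^+ 3 * (4 / 5) * m k i i i t +
   (6 * (3 / 5) ^+ 2 * (4 / 5) ^+ 2 * m i i k k t +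
   (- 4 * (3 / 5) * (4 / 5) ^+ 3 * m i k k k t +
    (4 / 5) ^+ 4 * m k k k k t))))); last first.
  by apply/funext => t; rewrite !tnth_mktuple eqxx /m; field.
rewrite !sphere_expD ?sphere_expZ; 
  do ?[exact: bm|exact: bM4|apply: sphere_boundedD].
rewrite -/(moment4 i i i i) -/(moment4 k i i i) -/(moment4 i i k k).
rewrite -/(moment4 i k k k) -/(moment4 k k k k) (moment4_diag k i).
rewrite (@moment4_single k i i i)// (@moment4_single i k k k)//.
lra.
Qed.

(** Expand [|t|^4], whose expectation is 1: the [n] diagonal terms are [3 * b] and the [n * (n - 1)]
    others are [b], so [n * (n + 2) * b = 1]. *)
Lemma moment4_value i k : i != k -> moment4 i i k k = (n%:R * (n%:R + 2))^-1.
Proof.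
move=> ik; set b := moment4 i i k k.
have a3 j : moment4 j j j j = 3 * b by rewrite (moment4_diag j i) (moment4_pair
  ik).
have bE j l : j != l -> moment4 j j l l = b.
  by move=> jl; have := a3 j; rewrite (moment4_pair jl) => h; lra.
have := @sphere_exp_sphere R n _ n0 (@sphere_bounded_cst R n 1).
rewrite sphere_exp_cst => e1.
have bS : sphere_bounded (fun t : n.-tuple R => 1 * \sum_(k < n) tnth t k ^+ 2).
  apply: sphere_boundedM; first exact: sphere_bounded_cst.
  by apply: sphere_bounded_sum => j; exact: bM2.
have := sphere_exp_sphere n0 bS; rewrite e1.
rewrite (_ : (fun _ => _) = (fun t => \sum_(j < n) \sum_(l < n)
   (tnth t j * tnth t j * (tnth t l * tnth t l)))); last first.
  apply/funext => t; rewrite mul1r mulr_suml; apply: eq_bigr => j _.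
  by rewrite mulr_sumr; apply: eq_bigr => l _; rewrite !expr2.
rewrite sphere_exp_sum; last by move=> j; apply: sphere_bounded_sum => l;
  exact: bM4.
have -> : \sum_(j < n) sphere_exp (fun t => \sum_(l < n)
    (tnth t j * tnth t j * (tnth t l * tnth t l))) = n%:R * (n%:R + 2) * b.
  transitivity (\sum_(j < n) ((n%:R + 2) * b)); last first.
    by rewrite sumr_const card_ord -[LHS]mulr_natl mulrA.
  apply: eq_bigr => j _; rewrite sphere_exp_sum; last by move=> l; exact: bM4.
  rewrite (bigD1 j)//= -/(moment4 j j j j) a3.
  rewrite (eq_bigr (fun=> b)); last by move=> l lj; rewrite -(bE j l) // eq_sym.
  rewrite sumr_const cardC1 card_ord -[X in _ + X]mulr_natl -subn1 natrB//;
    ring.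
have nn : n%:R * (n%:R + 2) != 0 :> R.
  by rewrite mulf_neq0// ?pnatr_eq0 -?lt0n// gt_eqF// ltr_wpDl.
by move=> h; apply: (mulfI nn); rewrite h mulfV.
Qed.

(** One term for each pairing of the four indices. If [i] equals another index, a permutation brings
    the two to the front and [pair] applies; otherwise [i] occurs once and the moment vanishes. *)
Lemma moment4E i j k l : moment4 i j k l = (n%:R * (n%:R + 2))^-1 *
  (((i == j) && (k == l))%:R + ((i == k) && (j == l))%:R
   + ((i == l) && (j == k))%:R).
Proof.
have pair i' k' l' : moment4 i' i' k' l' = (n%:R * (n%:R + 2))^-1 *
    ((k' == l')%:R + 2 * ((i' == k') && (i' == l'))%:R).
  have [<-|kl] := eqVneq k' l'.
    have [<-|ik] := eqVneq i' k'; last by rewrite moment4_value//=; ring.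
    (* The fourth moment of one coordinate is three times a mixed moment, which needs a second
       index. *)
    have [m im] : exists m, i' != m.
      exists (if i' == Ordinal n0 then Ordinal (leq_trans (isT : (1 < 5)%N) n4)
        else Ordinal n0).
      by have [->|] := eqVneq i' (Ordinal n0).
    by rewrite (moment4_pair im) moment4_value//=; ring.
  have -> : (i' == k') && (i' == l') = false.
    by apply: contraNF kl => /andP[/eqP <- /eqP <-].
  have [ki|ki] := eqVneq k' i'.
    rewrite moment4_34 moment4_23 moment4_12 moment4_single ?mulr0 ?addr0
      ?mulr0//;
    by rewrite eq_sym -?ki.
  by rewrite moment4_23 moment4_12 moment4_single ?mulr0 ?addr0 ?mulr0.
have [<-|ij] := eqVneq i j.
  by rewrite pair /=; case: (k == l); case: (i == k); case: (i == l);
    rewrite /=; ring.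
have ji : (j == i) = false by rewrite eq_sym (negbTE ij).
have [<-|ik] := eqVneq i k.
  rewrite moment4_23 pair (negbTE ij) ji.
  by case: (j == l); case: (i == l); rewrite /=; ring.
have [<-|il] := eqVneq i l.
  by rewrite moment4_34 moment4_23 pair (negbTE ij) (negbTE ik) /=;
    case: (j == k); rewrite /=; ring.
by rewrite moment4_single //=; ring.
Qed.

(** Multiply by [|t|^2 = 1] and sum the fourth moments: for [i = j] the pairings contribute [n + 2],
    which cancels a factor of the denominator. *)
Lemma sphere_exp_coord2 i j :
  sphere_exp (fun t : n.-tuple R => tnth t i * tnth t j) = (i == j)%:R / n%:R.
Proof.
rewrite -(sphere_exp_sphere n0 (bM2 i j)).
rewrite (_ : (fun _ => _) = (fun t => \sum_(k < n)
   (tnth t i * tnth t j * (tnth t k * tnth t k)))); last first.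
  by apply/funext => t; rewrite mulr_sumr; apply: eq_bigr => l _; rewrite expr2.
rewrite sphere_exp_sum; last by move=> l; exact: bM4.
under eq_bigr do rewrite -/(moment4 i j _ _) moment4E eqxx andbT.
rewrite -mulr_sumr !big_split/= sumr_const card_ord.
have -> : \sum_(k < n) ((i == k) && (j == k))%:R = (i == j)%:R :> R.
  rewrite (bigD1 i)//= eqxx big1 ?addr0 1?eq_sym// => k ki.
  by rewrite eq_sym (negbTE ki).
have n0' : n%:R != 0 :> R by rewrite pnatr_eq0 -lt0n.
have n2 : n%:R + 2 != 0 :> R by rewrite gt_eqF// ltr_wpDl.
rewrite -[X in X + _ + _]mulr_natl; move: n%:R n0' n2 => N N0 N2.
by case: (i == j); rewrite /=; field; rewrite N0.
Qed.

(** With [T] the trace of [B] and [c = 1 / (n * (n + 2))], the mean is [T / n] and the second moment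
    is [c] times the sum of [T^2], [S] and the products of each entry with its transpose. By the
    inequality of arithmetic and geometric means the last sum is at most [S], and [c <= 1 / n^2]
    lets the squared mean absorb [c * T^2]. *)
Lemma sphere_variance (B : 'I_n * 'I_n -> R) (q : n.-tuple R -> R) :
  (forall t, q t = \sum_u B u * (tnth t u.1 * tnth t u.2)) ->
  sphere_exp (fun t => (q t - sphere_exp q) ^+ 2) <=
  2 / (n%:R * (n%:R + 2)) * \sum_u B u ^+ 2.
Proof.
move=> /funext qE; pose T := \sum_u B u * (u.1 == u.2)%:R.
have bq u : sphere_bounded (fun t => B u * (tnth t u.1 * tnth t u.2)).
  by apply: sphere_boundedM; [exact: sphere_bounded_cst|exact: bM2].
have bQ : sphere_bounded q by rewrite qE; exact: sphere_bounded_sum.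
have Eq : sphere_exp q = T / n%:R.
  rewrite qE sphere_exp_sum// mulr_suml; apply: eq_bigr => u _.
  by rewrite sphere_expZ// sphere_exp_coord2 mulrA.
set c := (n%:R * (n%:R + 2))^-1; set S := \sum_u B u ^+ 2.
have n0' : 0 < n%:R :> R by rewrite ltr0n.
have c0 : 0 < c by rewrite invr_gt0 mulr_gt0// ltr_wpDl.
have Eqq : sphere_exp (fun t => q t * q t) <= c * (T ^+ 2 + 2 * S).
  rewrite (_ : (fun _ => _) = (fun t => \sum_u \sum_v B u * B v *
     (tnth t u.1 * tnth t u.2 * (tnth t v.1 * tnth t v.2)))); last first.
    apply/funext => t; rewrite qE mulr_suml; apply: eq_bigr => u _.
    by rewrite mulr_sumr; apply: eq_bigr => v _; ring.
  have bb u v : sphere_bounded (fun t => B u * B v *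
     (tnth t u.1 * tnth t u.2 * (tnth t v.1 * tnth t v.2))).
    by apply: sphere_boundedM; [exact: sphere_bounded_cst|exact: bM4].
  rewrite sphere_exp_sum; last by move=> u; exact: sphere_bounded_sum.
  (* The bound is spread over the entries [u], so that the comparison is made term by term. *)
  have -> : c * (T ^+ 2 + 2 * S) = \sum_u (c * (B u * (u.1 == u.2)%:R * T) +
      c * B u ^+ 2 + c * ((B u ^+ 2 + B (u.2, u.1) ^+ 2) / 2)).
    rewrite !big_split /= -!mulr_sumr -!mulr_suml -/T -/S big_split /= -/S.
    have -> : \sum_u B (u.2, u.1) ^+ 2 = S.
      rewrite /S [RHS](reindex (fun u : 'I_n * 'I_n => (u.2, u.1)))//=.
      by exists (fun u => (u.2, u.1)) => -[].
    by field.
  apply: ler_sum => u _; rewrite sphere_exp_sum//.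
  under eq_bigr do rewrite sphere_expZ//= -/(moment4 _ _ _ _) moment4E -/c.
  (* For fixed [u], the first pairing yields the trace, the second only [v = u], the third only the
     transposed entry. *)
  have -> : \sum_v B u * B v * (c * (((u.1 == u.2) && (v.1 == v.2))%:R +
      ((u.1 == v.1) && (u.2 == v.2))%:R + ((u.1 == v.2) && (u.2 == v.1))%:R)) =
      c * (B u * (u.1 == u.2)%:R * T) + c * B u ^+ 2 + c * (B u * B (u.2, u.1)).
    rewrite (eq_bigr (fun v =>
      c * (B u * (u.1 == u.2)%:R * (B v * (v.1 == v.2)%:R)) +
      (if v == u then c * (B u * B v) else 0) +
      (if v == (u.2, u.1) then c * (B u * B v) else 0))).
      by rewrite !big_split /= -!big_mkcond !big_pred1_eq -!mulr_sumr -/T expr2.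
    move=> v _; rewrite -mulnb natrM.
    have -> : (v == u) = (u.1 == v.1) && (u.2 == v.2).
      by case: u v => u1 u2 [v1 v2]; rewrite xpair_eqE ![v1 == _]eq_sym ![v2 ==
        _]eq_sym.
    have -> : (v == (u.2, u.1)) = (u.1 == v.2) && (u.2 == v.1).
      by case: u v => u1 u2 [v1 v2]; rewrite xpair_eqE/= [v1 == _]eq_sym [v2 ==
        _]eq_sym andbC.
    by case: (_ && (u.2 == v.2)); case: (_ && (u.2 == v.1)); rewrite /=; ring.
  rewrite lerD2l ler_pM2l//.
  by have := sqr_ge0 (B u - B (u.2, u.1)); nra.
rewrite (_ : (fun _ => _) = fun t => q t * q t + (- 2 * sphere_exp q * q t +
  sphere_exp q ^+ 2)); last first.
  by apply/funext => t; ring.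
have bc a : sphere_bounded (fun=> a : R) by exact: sphere_bounded_cst.
rewrite sphere_expD; [|exact: sphere_boundedM|by apply: sphere_boundedD => //;
  exact: sphere_boundedM].
rewrite sphere_expD ?sphere_expZ ?sphere_exp_cst//; last exact: sphere_boundedM.
rewrite Eq.
have cT : c * T ^+ 2 <= (T / n%:R) ^+ 2.
  rewrite expr_div_n mulrC ler_wpM2l ?sqr_ge0// lef_pV2 ?posrE; [nra| |].
    by rewrite mulr_gt0// ltr_wpDl.
  exact: exprn_gt0.
by move: Eqq cT; rewrite -/c; set e := T / _; nra.
Qed.

End sphere_moments.

(** * Real and imaginary parts of the numerical form as real quadratic forms *)

Section numerical_range.
Set Implicit Arguments.
Unset Strict Implicit.
Local Open Scope complex_scope.
Context {R : realType} (n : nat).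
Implicit Types (A : 'M[R[i]]_n) (x y : 'cV[R[i]]_n) (t : (n + n).-tuple R).

Definition real_coord y (p : 'I_(n + n)) : R :=
  match fintype.split p with
  | inl i => complex.Re (y i 0)
  | inr i => complex.Im (y i 0)
  end.

Definition std_tuple (p : 'I_(n + n)) : (n + n).-tuple R :=
  [tuple (k == p)%:R | k < n + n].

Lemma real_coord_sum y (F : 'I_(n + n) -> R -> R) :
  \sum_p F p (real_coord y p) =
  \sum_(i < n) (F (lshift n i) (complex.Re (y i 0))
              + F (rshift n i) (complex.Im (y i 0))).
Proof.
rewrite big_split_ord /= -big_split /=; apply: eq_bigr => i _.
by rewrite /real_coord (unsplitK (inl i)) (unsplitK (inr i)).
Qed.

Lemma enorm_sq y : enorm y ^+ 2 = \sum_p real_coord y p ^+ 2.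
Proof.
rewrite (real_coord_sum y (fun _ a => a ^+ 2)) sqr_sqrtr /inner raddf_sum /=.
  apply: eq_bigr => i _; case: (y i 0) => a b /=; ring.
by apply: sumr_ge0 => i _; case: (y i 0) => a b /=; nra.
Qed.

Lemma Re_inner y t :
  complex.Re (inner y (cvec t)) = \sum_p real_coord y p * tnth t p.
Proof.
rewrite (real_coord_sum y (fun p a => a * tnth t p)) /inner raddf_sum /=.
by apply: eq_bigr => i _; rewrite mxE; case: (y i 0) => a b /=; ring.
Qed.

Lemma real_coordK x : cvec [tuple real_coord x p | p < n + n] = x.
Proof.
apply/matrixP => i j; rewrite (ord1 j) mxE !tnth_mktuple /real_coord.
by rewrite (unsplitK (inl i)) (unsplitK (inr i)); case: (x i 0).
Qed.

Lemma cvec_std t : cvec t = \sum_p (tnth t p)%:C *: cvec (std_tuple p).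
Proof.
apply/matrixP => i j; rewrite (ord1 j) summxE mxE; apply/eqP;
  rewrite eq_complex /=.
rewrite !raddf_sum /=; apply/andP; split; apply/eqP.
  rewrite (bigD1 (lshift n i))//= !mxE !tnth_mktuple/= eqxx big1 ?addr0;
    first by rewrite mul0r subr0 mulr1.
  by move=> p pi; rewrite !mxE !tnth_mktuple /= eq_sym (negbTE pi) mulr0 mul0r
    subrr.
rewrite (bigD1 (rshift n i))//= !mxE !tnth_mktuple/= eqxx big1 ?addr0;
  first by rewrite mul0r addr0 mulr1.
by move=> p pi; rewrite !mxE !tnth_mktuple /= eq_sym (negbTE pi) mulr0 mul0r
  addr0.
Qed.

Lemma real_coord_mulmx A t q : real_coord (A *m cvec t) q =
  \sum_p tnth t p * real_coord (A *m cvec (std_tuple p)) q.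
Proof.
rewrite cvec_std mulmx_sumr /real_coord.
case: (fintype.split q) => i; rewrite summxE raddf_sum; apply: eq_bigr => p _;
  by rewrite -scalemxAr mxE; case: (_ i 0) => a b /=; ring.
Qed.

(** The matrix is that of [A] as a real linear map: row [p] holds the real coordinates of the image
    of the [p]-th basis vector, so its norm is at most [op_norm A]. *)
Lemma Re_quad_form A t : complex.Re (quad_form A t) =
  \sum_u real_coord (A *m cvec (std_tuple u.1)) u.2 * (tnth t u.1 * tnth t u.2).
Proof.
rewrite /quad_form Re_inner.
rewrite -(pair_bigA _ (fun p q => real_coord (A *m cvec (std_tuple p)) q *
  (tnth t p * tnth t q)))/=.
rewrite exchange_big /=; apply: eq_bigr => q _.
by rewrite real_coord_mulmx mulr_suml; apply: eq_bigr => p _; ring.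
Qed.

Lemma enorm_std_tuple p : enorm (cvec (std_tuple p)) = 1.
Proof.
rewrite enorm_cvec /tuple_norm (bigD1 p)//= tnth_mktuple eqxx big1.
  by rewrite addr0 expr1n sqrtr1.
by move=> k kp; rewrite tnth_mktuple (negbTE kp) expr0n.
Qed.

(** Boundedness is what makes the [sup] in [op_norm] an upper bound. A unit vector has real
    coordinates of modulus at most 1, which gives this crude bound. *)
Lemma enorm_mulmx_bounded A : exists K : R, forall x, enorm x = 1 ->
  enorm (A *m x) <= K.
Proof.
pose a p q := real_coord (A *m cvec (std_tuple p)) q.
exists (Num.sqrt (\sum_q (\sum_p `|a p q|) ^+ 2)) => x x1.
rewrite -[leLHS]ger0_norm ?sqrtr_ge0// -sqrtr_sqr ler_sqrt; last first.
  by apply: sumr_ge0 => q _; exact: sqr_ge0.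
rewrite enorm_sq; apply: ler_sum => q _.
rewrite -{1}(real_coordK x) real_coord_mulmx -real_normK ?num_real//.
rewrite ler_pXn2r ?nnegrE ?sumr_ge0//.
apply: (le_trans (ler_norm_sum _ _ _)); apply: ler_sum => p _.
rewrite tnth_mktuple normrM ler_piMl// -sqrtr_sqr -[leRHS]sqrtr1 ler_sqrt//.
have := enorm_sq x; rewrite x1 expr1n => ->; rewrite (bigD1 p)//= lerDl.
by apply: sumr_ge0 => k _; exact: sqr_ge0.
Qed.

Lemma enorm_le_op_norm A x : enorm x = 1 -> enorm (A *m x) <= op_norm A.
Proof.
move=> x1; have [K AK] := enorm_mulmx_bounded A.
by apply: ub_le_sup; [exists K => _ [y y1 <-]; exact: AK|exists x].
Qed.

Lemma quad_formZ (c : R[i]) A t : quad_form (c *: A) t = c * quad_form A t.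
Proof.
rewrite /quad_form /inner mulr_sumr; apply: eq_bigr => i _.
by rewrite -scalemxAl mxE mulrA.
Qed.

(** Multiplication by [- 'i] is an isometry and turns imaginary parts into real parts, so the bound
    for the latter covers both. *)
Lemma op_norm_mulNi A : op_norm ((- 'i) *: A) = op_norm A.
Proof.
congr sup; apply: eq_imagel => x _ /=.
congr Num.sqrt; congr complex.Re; apply: eq_bigr => i _.
rewrite -scalemxAl mxE; case: ((A *m x) i 0) => a b.
by apply/eqP; rewrite eq_complex /=; apply/andP; split; apply/eqP; ring.
Qed.

Lemma Im_quad_form A t :
  complex.Im (quad_form A t) = complex.Re (quad_form ((- 'i) *: A) t).
Proof. by rewrite quad_formZ; case: quad_form => a b /=; ring. Qed.

Lemma sphere_bounded_Re_quad_form A :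
  sphere_bounded (fun t => complex.Re (quad_form A t)).
Proof.
under eq_fun do rewrite Re_quad_form.
apply: sphere_bounded_sum => u.
by do !apply: sphere_boundedM; rewrite //;
  do ?[exact: sphere_bounded_cst|exact: sphere_bounded_coord].
Qed.

Lemma sphere_bounded_Im_quad_form A :
  sphere_bounded (fun t => complex.Im (quad_form A t)).
Proof.
under eq_fun do rewrite Im_quad_form.
exact: sphere_bounded_Re_quad_form.
Qed.

(** In dimension [2 n] the squared entries sum to at most [2 n] times [op_norm A ^+ 2], so the
    variance is at most [op_norm A ^+ 2 / (n + 1)]. The condition on [n] gives [4 < n + n]. *)
Lemma Re_quad_form_variance A : (2 < n)%N ->
  let q t := complex.Re (quad_form A t) in
  sphere_exp (fun t => (q t - sphere_exp q) ^+ 2) <= op_norm A ^+ 2 / n%:R.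
Proof.
move=> n2.
have nn4 : (4 < n + n)%N by rewrite (leq_trans _ (leq_add n2 n2)).
apply: (le_trans (sphere_variance nn4 (Re_quad_form A))).
have n0 : 0 < n%:R :> R by rewrite ltr0n (leq_trans _ n2).
rewrite natrD.
apply: (@le_trans _ _ (2 / ((n%:R + n%:R) * (n%:R + n%:R + 2)) *
  ((n%:R + n%:R) * op_norm A ^+ 2))).
  rewrite ler_pM2l; last by rewrite divr_gt0// mulr_gt0// !addr_gt0.
  rewrite -(pair_bigA _ (fun p q => real_coord (A *m cvec (std_tuple p)) q ^+
    2))/=.
  apply: (@le_trans _ _ (\sum_(p < n + n) op_norm A ^+ 2)).
    apply: ler_sum => p _; rewrite -enorm_sq.
    have h := enorm_le_op_norm A (enorm_std_tuple p).
    have e0 : 0 <= enorm (A *m cvec (std_tuple p)) by exact: sqrtr_ge0.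
    by rewrite ler_sqr ?nnegrE// (le_trans e0 h).
  by rewrite sumr_const card_ord -[leLHS]mulr_natl natrD.
rewrite [leLHS](_ : _ = op_norm A ^+ 2 / (n%:R + 1)); last first.
  by field; rewrite !gt_eqF// ?addr_gt0.
by rewrite ler_wpM2l ?sqr_ge0// lef_pV2 ?posrE ?addr_gt0// lerDl.
Qed.

Lemma Im_quad_form_variance A : (2 < n)%N ->
  let q t := complex.Im (quad_form A t) in
  sphere_exp (fun t => (q t - sphere_exp q) ^+ 2) <= op_norm A ^+ 2 / n%:R.
Proof.
move=> /(Re_quad_form_variance ((- 'i) *: A)) /=; rewrite op_norm_mulNi.
rewrite (_ : (fun t => complex.Re _) =
  (fun t => complex.Im (quad_form A t))); last first.
  by apply/funext => t; rewrite Im_quad_form.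
by under eq_fun do rewrite -Im_quad_form.
Qed.

End numerical_range.

(** * Concentration of the numerical measure around its mean *)

Section concentration.
Set Implicit Arguments.
Unset Strict Implicit.
Local Open Scope complex_scope.
Context {R : realType}.

(** The squared modulus of [z - w] as an element of [R]; the norm of [R[i]] takes its values in
    [R[i]]. *)
Definition sqdist (z w : R[i]) : R :=
  (complex.Re z - complex.Re w) ^+ 2 + (complex.Im z - complex.Im w) ^+ 2.

Lemma sqdist_unif_continuous (f : R[i] -> R) : unif_continuous f ->
  forall e, 0 < e -> exists2 d, 0 < d &
    forall z w, sqdist z w < d ^+ 2 -> `|f z - f w| < e.
Proof.
move=> uf e e0.
have /uf : entourage [set xy : R * R | ball xy.1 e xy.2].
  exact: (entourage_ball R (PosNum e0)).
rewrite /nbhs /= -entourage_ballE => -[[d d1] /= d0 H].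
(* A positive element of [R[i]] is real. *)
have [d00 d10] : 0 < d /\ d1 = 0.
  by move: d0; rewrite ltcE /= => /andP[/eqP -> ?].
subst d1; exists d => // z w zw.
apply: (H (z, w)); rewrite /= -ball_normE /=; apply: normc_lt => //.
by move: zw; rewrite /sqdist; case: z w => [? ?] [? ?].
Qed.

(** Such an [f] is continuous, so preimages of open intervals are open, and the open sets generate
    the sigma-algebra of [R[i]]. It serves for [Re], [Im] and the test functions. *)
Lemma sqdist_measurable (f : R[i] -> R) :
  (forall e, 0 < e -> exists2 d, 0 < d &
    forall z w, sqdist z w < d ^+ 2 -> `|f z - f w| < e) ->
  measurable_fun setT f.
Proof.
move=> hf; have /continuousP cf : continuous f.
  move=> z; apply/(@cvgrPdist_lt _ _ _ (nbhs z) (nbhs_filter z)) => e e0;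
    have [d d0 h] := hf e e0.
  apply/nbhs_ballP; exists d%:C; first by rewrite /= ltcR.
  move=> w; rewrite -ball_normE /= normc_def ltcR => zw; apply: h.
  rewrite -(@ltr_sqrt _ _ (d ^+ 2)) ?exprn_gt0// sqrtr_sqr (ger0_norm (ltW d0)).
  by move: zw; rewrite /sqdist; case: z w => [? ?] [? ?].
apply: (measurability _ (RGenOpens.measurableE R)).
move=> _ [_ [a [b ->] <-]]; rewrite setTI; apply: sub_sigma_algebra.
exact/cf/interval_open.
Qed.

Lemma measurable_Re : measurable_fun setT (@complex.Re R : R[i] -> R).
Proof.
apply: sqdist_measurable => e e0; exists e => // z w zw.
rewrite -[ltRHS](ger0_norm (ltW e0)) -!sqrtr_sqr ltr_sqrt ?exprn_gt0//.
by rewrite (le_lt_trans _ zw)// lerDl sqr_ge0.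
Qed.

Lemma measurable_Im : measurable_fun setT (@complex.Im R : R[i] -> R).
Proof.
apply: sqdist_measurable => e e0; exists e => // z w zw.
rewrite -[ltRHS](ger0_norm (ltW e0)) -!sqrtr_sqr ltr_sqrt ?exprn_gt0//.
by rewrite (le_lt_trans _ zw)// lerDr sqr_ge0.
Qed.

Lemma Rintegral_numerical_measure n (A : 'M[R[i]]_n) (h : R[i] -> R) :
  measurable_fun setT h -> sphere_bounded (fun t => h (quad_form A t)) ->
  (\int[numerical_measure A]_z h z)%R = sphere_exp (fun t => h (quad_form A t)).
Proof.
move=> mh bh; congr fine.
rewrite [LHS](@integral_distribution _ _ _ _ _ (sphere_measure (n + n))
  (quad_form A) (EFin \o h))//.
  exact/measurable_EFinP.
exact: sphere_bounded_integrable.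
Qed.

(** The parts of the first moment are the means of the real and imaginary parts of the form, so the
    expected squared distance is the sum of the two variances. *)
Lemma numerical_measure_concentration n (A : 'M[R[i]]_n) : (2 < n)%N ->
  sphere_bounded (fun t =>
    sqdist (quad_form A t) (first_moment (numerical_measure A))) /\
  sphere_exp (fun t =>
    sqdist (quad_form A t) (first_moment (numerical_measure A))) <=
  2 * (op_norm A ^+ 2 / n%:R).
Proof.
move=> n2; have bR := sphere_bounded_Re_quad_form A.
have bI := sphere_bounded_Im_quad_form A.
rewrite /first_moment !Rintegral_numerical_measure//;
  [|exact: measurable_Im|exact: measurable_Re].
have bsq (q : (n + n).-tuple R -> R) c : sphere_bounded q ->
    sphere_bounded (fun t => (q t - c) ^+ 2).
  move=> bq; have bqc : sphere_bounded (fun t => q t - c).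
    by apply: sphere_boundedD => //; exact: sphere_bounded_cst.
  exact: (sphere_boundedM bqc bqc).
have b1 := bsq _ (sphere_exp (fun t => complex.Re (quad_form A t))) bR.
have b2 := bsq _ (sphere_exp (fun t => complex.Im (quad_form A t))) bI.
split; first exact: (sphere_boundedD b1 b2).
rewrite /sqdist /= (sphere_expD b1 b2) mulrDl mul1r.
by apply: lerD; [exact: Re_quad_form_variance|exact: Im_quad_form_variance].
Qed.

Lemma sphere_exp_norm_le n (F G : n.-tuple R -> R) :
  sphere_bounded F -> sphere_bounded G -> (forall t, `|F t| <= G t) ->
  `|sphere_exp F| <= sphere_exp G.
Proof.
move=> /sphere_bounded_integrable iF /sphere_bounded_integrable iG FG.
apply: (le_trans (le_normr_Rintegral _ iF)) => //.
by apply: le_Rintegral => //; exact: integrable_norm.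
Qed.

End concentration.

(** * From the variance bound to test functions *)

Theorem corollary8p2 (R : realType) (A : forall n : nat, 'M[R[i]]_n)
    (hA : (fun n : nat => op_norm (A n) ^+ 2 / n%:R) @ \oo --> (0 : R)) :
  diff_weakly_cvg0
    (fun n : nat => numerical_measure (A n))
    (fun n : nat => \d_(first_moment (numerical_measure (A n)))).
Proof.
move=> f [M fM] uf.
have hf := sqdist_unif_continuous uf; have mf := sqdist_measurable hf.
have M0 : 0 <= M := le_trans (normr_ge0 _) (fM 0).
apply/cvgr0Pnorm_lt => e e0.
have [d d0 fd] := hf (e / 2) (divr_gt0 e0 (ltr0n _ 2)).
(* Chosen so that [2 * M <= K * sqdist z w] as soon as [d ^+ 2 <= sqdist z w]. *)
pose K := 2 * M / d ^+ 2.
have d2 : 0 < d ^+ 2 by rewrite exprn_gt0.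
have K0 : 0 <= K by rewrite divr_ge0 ?mulr_ge0// ltW.
(* If [x] is below this threshold, then [K * (2 * x) < e / 2]; [K + 1] keeps the denominator
   positive when [K = 0]. *)
have eK : 0 < e / (4 * (K + 1)) by rewrite divr_gt0// mulr_gt0// ltr_wpDl.
move/cvgr0Pnorm_lt : hA => /(_ _ eK) hA.
near=> n.
have n2 : (2 < n)%N by near: n; exact: nbhs_infty_gt.
set w := first_moment _.
have -> : (\int[\d_w]_z f z)%R = f w.
  rewrite /Rintegral integral_dirac//; last exact/measurable_EFinP.
  by rewrite diracT mul1e.
have bf : sphere_bounded (fun t => f (quad_form (A n) t)).
  split; first exact: (measurableT_comp mf (measurable_quad_form (A n))).
  by exists M => t.
rewrite Rintegral_numerical_measure//.
have [bs Es] := numerical_measure_concentration (A n) n2; rewrite -/w in bs Es.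
have bw : sphere_bounded (fun _ : (n + n).-tuple R => - f w).
  exact: sphere_bounded_cst.
have -> : sphere_exp (fun t => f (quad_form (A n) t)) - f w =
    sphere_exp (fun t => f (quad_form (A n) t) - f w).
  by rewrite (sphere_expD bf bw) sphere_exp_cst.
(* A pointwise majorant of [|f z - f w|]: the first term covers [z] near [w], the second covers the
   rest. *)
pose G (t : (n + n).-tuple R) := e / 2 + K * sqdist (quad_form (A n) t) w.
have be : sphere_bounded (fun _ : (n + n).-tuple R => e / 2).
  exact: sphere_bounded_cst.
have bKs : sphere_bounded (fun t => K * sqdist (quad_form (A n) t) w).
  by apply: sphere_boundedM => //; exact: sphere_bounded_cst.
apply: (@le_lt_trans _ _ (sphere_exp G)).
  apply: sphere_exp_norm_le;
    [exact: (sphere_boundedD bf bw)|exact: (sphere_boundedD be bKs)|].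
  move=> t; rewrite /G; set z := quad_form _ _.
  have s0 : 0 <= sqdist z w by rewrite addr_ge0 ?sqr_ge0.
  have [zw|zw] := ltP (sqdist z w) (d ^+ 2).
    by rewrite (le_trans (ltW (fd _ _ zw)))// lerDl mulr_ge0.
  apply: (le_trans (ler_normB _ _)).
  apply: (@le_trans _ _ (2 * M)); first by have := fM z; have := fM w; lra.
  apply: (@le_trans _ _ (K * d ^+ 2)); first by rewrite /K divfK// gt_eqF.
  by rewrite (@le_trans _ _ (K * sqdist z w))// ?ler_wpM2l// lerDr divr_ge0//
    ltW.
rewrite (sphere_expD be bKs) sphere_exp_cst sphere_expZ//.
have : `|op_norm (A n) ^+ 2 / n%:R| < e / (4 * (K + 1)) by near: n.
rewrite ger0_norm ?divr_ge0 ?sqr_ge0//; move: Es.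
set x := op_norm _ ^+ 2 / _; set E := sphere_exp _ => Es.
rewrite ltr_pdivlMr ?mulr_gt0 ?ltr_wpDl// => xe.
have x0 : 0 <= x by rewrite divr_ge0 ?sqr_ge0.
have : K * E <= K * (2 * x) by rewrite ler_wpM2l.
nra.
Unshelve. all: by end_near.
Qed.
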